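(* There is an absolute constant $K>0$ such that the following holds for all positive integers $k,n$ with $n\ge K k^{9}$. If $G$ is an $N$-vertex graph with $N>(n-1)(k-1)$, then $f(G)\ge k$ or $\hom(G)\ge n$.
   Context: Graphs are finite and simple, and have at least one vertex. A set $U\subset V(G)$ is homogeneous if $G[U]$ is complete or empty (has no edges), and $\hom(G)$ is the size of a largest homogeneous set in $G$. $f(G)$ denotes the largest $k\in\mathbb{N}$ such that $G$ has an induced subgraph $H$ with $k$ distinct degrees, i.e. such that the set $\{d_H(v):v\in V(H)\}$ has at least $k$ elements. *)

(* Defs.v *)
From mathcomp Require Import all_boot.

Set Implicit Arguments.
Unset Strict Implicit.
Unset Printing Implicit Defensive.

(* A graph is its adjacency relation [e] on the finite type [T] of vertices;
   simplicity ([symmetric e], [irreflexive e]) is assumed where it is needed. *)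

Definition complete_on (T : finType) (e : rel T) (U : {set T}) : bool :=
  [forall u in U, forall v in U, (u != v) ==> e u v].

Definition edgeless_on (T : finType) (e : rel T) (U : {set T}) : bool :=
  [forall u in U, forall v in U, ~~ e u v].

Definition homogeneous (T : finType) (e : rel T) (U : {set T}) : bool :=
  complete_on e U || edgeless_on e U.

Definition hom_num (T : finType) (e : rel T) : nat :=
  \max_(U : {set T} | homogeneous e U) #|U|.

Definition induced_degree (T : finType) (e : rel T) (H : {set T}) (v : T) : nat :=
  #|[set u in H | e v u]|.

Definition num_distinct_degrees (T : finType) (e : rel T) (H : {set T}) : nat :=
  size (undup [seq induced_degree e H v | v in H]).

(* Graphs have at least one vertex, hence [H != set0]. *)
Definition max_distinct_degrees (T : finType) (e : rel T) : nat :=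
  \max_(H : {set T} | H != set0) num_distinct_degrees e H.

(* Main.v *)
Require Import Defs.
From mathcomp Require Import all_boot zify.

Set Implicit Arguments.
Unset Strict Implicit.
Unset Printing Implicit Defensive.

(** Write dist u v for the size of the symmetric difference of the neighbourhoods
of u and v, and suppose that hom(G) < n.

Far vertices get distinct degrees.  If the vertices of a set X of size at most k
are at distance at least 7k^6 whenever some relation far holds between them, then
a set S can be chosen, avoiding any prescribed set U of k^2 vertices, so that the
numbers of neighbours in S of far vertices differ by more than k^2
([separate_far]).  The gap k^2 leaves room to add any part of U to S later.  In
particular k pairwise far vertices give f(G) >= k ([far_family_degrees]), so
otherwise a maximal pairwise far set has fewer than k elements.  Linking those of
its elements that are close to one another splits V(G) into fewer than k clusters
such that vertices of different clusters are far, while vertices of one cluster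
are within d = O(k^7) of each other ([exists_clusters]).

Inside a cluster C all vertices look alike, which forces G[C] or its complement to
have maximum degree O(d) ([cluster_sparse]); let adjacent mean adjacent in that
sparse graph.  Since hom(G) < n, every subset of C with more than (n-1)t vertices
contains a vertex x with a set Y of t neighbours ([exists_large_bdegree]).  Such a
pair (x, Y) is a gadget: putting s of the vertices of Y into the induced subgraph
moves the degree of x by s relative to the earlier vertices x' of its cluster.
Gadgets are picked one after the other, avoiding at each step the O(kd) = O(k^8)
vertices that distinguish the earlier x's of one cluster; hence a later gadget
does not disturb the degree differences settled by the earlier ones.  Every later
gadget with |Y| = t has t + 1 options and can avoid the degrees of t earlier
vertices of its cluster ([tune_chain]).

Counting.  Label each cluster with a multiplicity t such that the cluster has more
than (n-1)(t-1) vertices with O(k^8) to spare.  As there are fewer than k clusters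
and n >= K k^9, the losses add up to less than n, so labels of total multiplicity
k - 1 exist ([exists_labels]).  This gives t gadgets with |Y| = t - 1 in a cluster
of multiplicity t, hence k - 1 distinct degrees.  For one more, note that
N > (n-1)(k-1) leaves some cluster with more than (n-1)t vertices, where t is its
multiplicity ([exists_rich_label]).  Without anything to spare, this gives a single
vertex x0 with a set Y0 of t neighbours and no control on how Y0 meets the other
clusters.  So Y0 is used all or nothing, before any tuning: together with the
first gadget (x1, Y1) of that cluster, also used all or nothing, it forces the
degrees of x0 and x1 to differ by at least t ([force_gap]).  The t consecutive
degrees available to a later gadget of the cluster then never contain both of
them, so that t options suffice against the up to t earlier vertices. *)

(** * Subsets, lines and degrees *)

Lemma subset_of_card (T : finType) (A : {set T}) c :
  c <= #|A| -> exists2 B : {set T}, B \subset A & #|B| = c.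
Proof.
move=> le_c; exists [set x in take c (enum A)].
  by apply/subsetP=> x; rewrite inE => /mem_take; rewrite mem_enum.
rewrite cardsE (card_uniqP _) ?take_uniq ?enum_uniq // size_take -cardE.
by case: ltngtP le_c.
Qed.

Lemma card_bigcup_le_sum (I : Type) (T : finType) (r : seq I) (P : pred I) (F : I -> {set T}) :
  #|\bigcup_(i <- r | P i) F i| <= \sum_(i <- r | P i) #|F i|.
Proof.
elim/big_rec2: _ => [|i m A _ leA]; first by rewrite cards0.
by rewrite (leq_trans (leq_card_setU _ _)) ?leq_add2l.
Qed.

(** Greedy choice: the subsets already taken remove at most
[(size s - 1) * c] elements from the next [A i]. *)
Lemma disjoint_subsets (I : eqType) (T : finType) (A : I -> {set T}) c (s : seq I) :
    uniq s -> (forall i, i \in s -> size s * c <= #|A i|) ->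
  exists Q : I -> {set T},
    (forall i, i \in s -> Q i \subset A i /\ #|Q i| = c) /\
    {in s &, forall i j, i != j -> [disjoint Q i & Q j]}.
Proof.
move=> us big; have [m le_sm bigm] : exists2 m, size s <= m &
    forall i, i \in s -> m * c <= #|A i| by exists (size s).
(* The lower bound on the [A i] is kept fixed while [s] shrinks. *)
elim: s us le_sm {big} bigm => [|i s IH] /=; first by exists (fun=> set0).
case/andP=> iNs us lt_sm big; have [j js|Q [QA Qdis]] := IH us (ltnW lt_sm).
  by rewrite big // in_cons js orbT.
set U := \bigcup_(j <- s) Q j.
have leU : #|U| <= size s * c.
  apply: leq_trans (card_bigcup_le_sum _ _ _) _.
  rewrite big_seq (eq_bigr (fun=> c)) => [|j /QA[]//].
  by rewrite -big_seq big_const_seq iter_addn_0 count_predT mulnC.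
have [|B BA cB] := @subset_of_card _ (A i :\: U) c.
  have := big i (mem_head _ _); rewrite cardsD.
  have := subset_leq_card (subsetIr (A i) U); nia.
have dis j : j \in s -> [disjoint B & Q j].
  move=> js; apply: disjointWl BA _; rewrite disjoint_sym disjoints_subset.
  apply/subsetP=> x xQ; rewrite !inE negb_and negbK; apply/orP; left.
  by rewrite /U (big_rem j js) inE xQ.
exists (fun j => if j == i then B else Q j); split.
  move=> j; rewrite in_cons; case: eqVneq => [-> _|_ /= /QA//].
  by split=> //; apply: subset_trans BA (subsetDl _ _).
move=> j l; rewrite !in_cons.
have [->|ji] := eqVneq j i; have [->|li] := eqVneq l i => //=.
- by move=> _ ls _; apply: dis.
- by move=> js _ _; rewrite disjoint_sym dis.
- exact: Qdis.
Qed.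

(** A set that meets each line in direction [x] at most once has density at most
one over the length of the lines. *)
Lemma card_line_sparse (T : finType) (m : nat) (x : T) (B : {set {ffun T -> 'I_m.+1}}) :
    {in B &, forall p q : {ffun T -> 'I_m.+1}, (forall z, z != x -> p z = q z) -> p x = q x} ->
  #|B| * m.+1 <= #|{ffun T -> 'I_m.+1}|.
Proof.
move=> Bx; pose f (pr : {ffun T -> 'I_m.+1} * 'I_m.+1) : {ffun T -> 'I_m.+1} :=
  [ffun z => if z == x then pr.2 else pr.1 z].
have finj : {in setX B setT &, injective f}.
  move=> [p r] [q t]; rewrite !inE /= !andbT => pB qB /ffunP eqf.
  have eqz z : z != x -> p z = q z.
    by move=> zx; have := eqf z; rewrite !ffunE (negPf zx).
  have -> : r = t by have := eqf x; rewrite !ffunE eqxx.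
  congr pair; apply/ffunP=> z; have [->|/eqz//] := eqVneq z x; exact: Bx.
have := max_card [in f @: setX B setT]; rewrite card_in_imset // cardsX cardsT card_ord.
exact.
Qed.

(** Pigeonhole principle: each element of [E] forbids at most one of the [c.+1]
values [0, ..., c]. *)
Lemma avoid_few (T : finType) (R : nat -> T -> bool) (E : {set T}) c :
    (forall v s t, v \in E -> s <= c -> t <= c -> R s v -> R t v -> s = t) ->
    #|E| <= c -> exists2 s, s <= c & {in E, forall v, ~~ R s v}.
Proof.
move=> Runiq leE.
have [/existsP[s /forall_inP sE]|] := boolP [exists s : 'I_c.+1, forall v in E, ~~ R s v].
  by exists s => //; rewrite -ltnS.
rewrite negb_exists => /forallP all_bad.
have bad (s : 'I_c.+1) : {v | (v \in E) && R s v}.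
  apply: sigW; have := all_bad s; rewrite negb_forall_in => /exists_inP[v vE].
  by rewrite negbK => Rv; exists v; rewrite vE.
have finj : injective (fun s => sval (bad s)).
  move=> s t eq_st; apply: val_inj => /=.
  have /andP[sE Rs] := svalP (bad s); have /andP[tE Rt] := svalP (bad t).
  by apply: (Runiq (sval (bad s))); rewrite // ?eq_st // -ltnS.
suff : c.+1 <= #|E| by rewrite ltnNge leE.
rewrite -[c.+1]card_ord -(card_codom finj); apply: subset_leq_card.
by apply/subsetP=> _ /codomP[s ->]; case/andP: (svalP (bad s)).
Qed.

Section Degrees.

Variables (T : finType) (e : rel T).
Implicit Types (u v x : T) (A B H : {set T}).

Local Notation deg := (induced_degree e).

Lemma degU H A v : [disjoint H & A] -> deg (H :|: A) v = deg H v + deg A v.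
Proof.
move=> dis; rewrite /induced_degree -(cardsUI _ [set u in A | e v u]).
rewrite [X in _ + X](_ : _ = 0) ?addn0.
  by apply: eq_card => u; rewrite !inE andb_orl.
apply/eqP; rewrite cards_eq0 -subset0; apply/subsetP=> u; rewrite !inE.
case/andP=> /andP[uH _] /andP[uA _]; have := disjointFr dis uH; by rewrite uA.
Qed.

Lemma deg_le A v : deg A v <= #|A|.
Proof. by apply: subset_leq_card; apply/subsetP=> u; rewrite inE => /andP[]. Qed.

Lemma deg_all A v b : {in A, forall u, e v u = b} -> deg A v = b * #|A|.
Proof.
move=> Ab; case: b Ab => Ab; rewrite ?mul1n ?mul0n.
  by apply: eq_card => u; rewrite inE; case: (boolP (u \in A)) => //= /Ab.
by apply/eqP; rewrite cards_eq0; apply/eqP/setP=> u; rewrite !inE; apply/andP=> -[/Ab->].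
Qed.

Lemma deg_eq A u v : {in A, forall w, e u w = e v w} -> deg A u = deg A v.
Proof. by move=> Auv; apply: eq_card => w; rewrite !inE; case: (boolP (w \in A)) => //= /Auv. Qed.

Lemma deg_in_max (k : nat) (H X : {set T}) : X \subset H -> k <= #|X| -> H != set0 ->
  {in X &, injective (deg H)} -> k <= max_distinct_degrees e.
Proof.
move=> XH kX H0 inj.
apply: leq_trans kX (@leq_trans (num_distinct_degrees e H) _ _ _ _); last exact: leq_bigmax_cond.
rewrite cardE -(size_map (deg H)); apply: uniq_leq_size.
  by rewrite map_inj_in_uniq ?enum_uniq // => x y; rewrite !mem_enum; apply: inj.
move=> d /mapP[x]; rewrite mem_enum mem_undup => xX ->.
by rewrite map_f // mem_enum (subsetP XH).
Qed.

(** If [u] and [v] are adjacent, then both of them are counted in [dist u v]. *)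
Definition dist u v := #|[set w | e u w != e v w]|.

Lemma dist_refl u : dist u u = 0.
Proof. by apply/eqP; rewrite cards_eq0; apply/eqP/setP=> w; rewrite !inE eqxx. Qed.

Lemma dist_sym u v : dist u v = dist v u.
Proof. by apply: eq_card => w; rewrite !inE eq_sym. Qed.

Lemma dist_triangle v u x : dist u x <= dist u v + dist v x.
Proof.
apply: leq_trans (leq_card_setU _ _); apply: subset_leq_card; apply/subsetP=> w.
by rewrite !inE; case: (e u w); case: (e v w); case: (e x w).
Qed.

End Degrees.

(** * Separating the degrees of far vertices *)

Section Separation.

Variables (T : finType) (e : rel T).
Implicit Types (u v x y : T) (S X U : {set T}).

Local Notation deg := (induced_degree e).
Local Notation dist := (dist e).

Lemma private_nbrs_large U x y m :
  2 * m + #|U| <= dist x y ->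
  m <= #|[set w | e x w & ~~ e y w] :\: U| \/ m <= #|[set w | e y w & ~~ e x w] :\: U|.
Proof.
move=> far_xy; set A := _ :\: U; set B := _ :\: U.
suff : dist x y <= #|A| + #|B| + #|U| by case: (leqP m #|A|) => [|ltA]; [left | right; lia].
apply: leq_trans (leq_trans (leq_card_setU (A :|: B) U) (leq_add (leq_card_setU _ _) (leqnn _))).
apply: subset_leq_card; apply/subsetP=> w; rewrite !inE.
by case: (w \in U); case: (e x w); case: (e y w).
Qed.

(** The set [S] of [separate_far] is built from pairwise disjoint blocks, indexed by
triples [(x, y, r)] with [r < k ^ 2].  A block consists of [2 * k ^ 2 + 1]
neighbours of [x] outside [U] that are not neighbours of [y].  A function [p]
prescribes how many of the blocks of each pair [(x, y)] are used, namely those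
with [r < p x].  Raising [p x] thus raises the degree of [x] relative to
that of [y] by at least [2 * k ^ 2 + 1], whatever the blocks of the other pairs
starting with [x] do, since all of them consist of neighbours of [x].  So for
fixed other values of [p] at most one value of [p x] brings the two degrees within
[k ^ 2] of each other. As there are [k ^ 2 + 1] values and at most [k ^ 2] pairs,
some [p] is good for all pairs. *)

Variables (k : nat) (X U : {set T}).
Hypotheses (k_gt0 : 0 < k) (leX : #|X| <= k) (leU : #|U| <= k ^ 2).

Let A (j : T * T * 'I_(k ^ 2)) := [set w | e j.1.1 w & ~~ e j.1.2 w] :\: U.

Let big x y := k ^ 4 * (2 * k ^ 2).+1 <= #|[set w | e x w & ~~ e y w] :\: U|.

Let J := [set j : T * T * 'I_(k ^ 2) | [&& j.1.1 \in X, j.1.2 \in X & big j.1.1 j.1.2]].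

Lemma card_J : #|J| <= k ^ 4.
Proof.
have : #|J| <= #|setX (setX X X) [set: 'I_(k ^ 2)]|.
  by apply: subset_leq_card; apply/subsetP=> j; rewrite !inE => /and3P[-> ->].
rewrite !cardsX cardsT card_ord => /leq_trans; apply.
by rewrite (_ : k ^ 4 = k * k * k ^ 2) ?leq_mul //; lia.
Qed.

Lemma exists_blocks : exists Q : T * T * 'I_(k ^ 2) -> {set T},
    (forall j, j \in J -> Q j \subset A j /\ #|Q j| = (2 * k ^ 2).+1) /\
    {in J &, forall i j, i != j -> [disjoint Q i & Q j]}.
Proof.
have [j|Q [QA Qdis]] := @disjoint_subsets _ _ A (2 * k ^ 2).+1 (enum J) (enum_uniq _).
  rewrite mem_enum inE => /and3P[_ _ bigj]; apply: leq_trans bigj.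
  by rewrite -cardE leq_mul2r card_J orbT.
exists Q; split=> [j jJ|i j iJ jJ]; first by apply: QA; rewrite mem_enum.
by apply: Qdis; rewrite mem_enum.
Qed.

Definition block_union (Q : T * T * 'I_(k ^ 2) -> {set T}) (p : {ffun T -> 'I_(k ^ 2).+1}) :=
  \bigcup_(j in J | j.2 < p j.1.1) Q j.

Section Blocks.

Variable Q : T * T * 'I_(k ^ 2) -> {set T}.
Hypothesis QA : forall j, j \in J -> Q j \subset A j /\ #|Q j| = (2 * k ^ 2).+1.
Hypothesis Qdis : {in J &, forall i j, i != j -> [disjoint Q i & Q j]}.

Local Notation S := (block_union Q).

Let bad x y := [set p | (deg (S p) x <= deg (S p) y + k ^ 2)
                        && (deg (S p) y <= deg (S p) x + k ^ 2)].

Lemma blocks_increase x y (p q : {ffun T -> 'I_(k ^ 2).+1}) :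
    x \in X -> y \in X -> big x y ->
    (forall z, z != x -> p z = q z) -> p x < q x ->
  deg (S p) x + deg (S q) y + (2 * k ^ 2).+1 <= deg (S q) x + deg (S p) y.
Proof.
move=> xX yX bigxy pq ltpq.
have ltr : p x < k ^ 2 by rewrite (leq_trans ltpq) // -ltnS.
set j0 : T * T * 'I_(k ^ 2) := (x, y, Ordinal ltr).
have j0J : j0 \in J by rewrite inE /= xX yX.
have [Q0A cQ0] := QA j0J.
have sub_pq : S p \subset S q.
  apply/bigcupsP=> j /andP[jJ ltj]; apply: (bigcup_sup j); rewrite jJ /=.
  by have [jx|/pq <- //] := eqVneq j.1.1 x; move: ltj; rewrite jx => /ltn_trans; apply.
pose D := S q :\: S p.
have SqE : S q = S p :|: D by rewrite -[LHS](setID _ (S p)) (setIidPr sub_pq).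
have disD : [disjoint S p & D] by rewrite disjoint_sym disjoints_subset subsetDr.
have Q0D : Q j0 \subset D.
  rewrite subsetD; apply/andP; split.
    by apply: (bigcup_sup j0); rewrite ?j0J.
  apply/bigcup_disjointP=> j /andP[jJ ltj].
  by apply: Qdis => //; apply: contraTneq ltj => <-; rewrite ltnn.
have Dx : {in D, forall w, e x w = true}.
  move=> w; rewrite inE => /andP[wNp /bigcupP[j /andP[jJ ltj] wQ]].
  have [jx|/pq jx] := eqVneq j.1.1 x.
    by have [/subsetP/(_ w wQ)] := QA jJ; rewrite !inE jx => /andP[_ /andP[]].
  by case/bigcupP: wNp; exists j; rewrite // jJ jx.
have degDy : deg D y + (2 * k ^ 2).+1 <= #|D|.
  rewrite -cQ0 -(cardsID (Q j0) D) addnC (setIidPr Q0D) leq_add2l.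
  apply: subset_leq_card; apply/subsetP=> w; rewrite inE => /andP[wD wy].
  rewrite inE wD andbT; apply: contraL wy => /(subsetP Q0A).
  by rewrite !inE => /andP[_ /andP[]].
rewrite SqE !degU // (deg_all Dx) mul1n; lia.
Qed.

Lemma card_bad x y : x \in X -> y \in X -> big x y ->
  #|bad x y| * (k ^ 2).+1 <= #|{ffun T -> 'I_(k ^ 2).+1}|.
Proof.
move=> xX yX bigxy; apply: (@card_line_sparse _ _ x) => p q.
rewrite !inE => /andP[p1 p2] /andP[q1 q2] pq; apply: val_inj => /=.
have [lt_pq|lt_pq|//] := ltngtP (p x) (q x).
  have := blocks_increase xX yX bigxy pq lt_pq; lia.
have := @blocks_increase x y q p xX yX bigxy _ lt_pq.
move=> /(_ (fun z zx => esym (pq z zx))); lia.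
Qed.

(** Union bound: each of the at most [k ^ 2] pairs excludes a fraction of at most
[1 / (k ^ 2 + 1)] of all [p]. *)
Lemma exists_good_blocks : exists p, {in X &, forall x y, big x y -> p \notin bad x y}.
Proof.
pose P := [set xy in setX X X | big xy.1 xy.2].
pose B := \bigcup_(xy in P) bad xy.1 xy.2.
suff : #|B| < #|{ffun T -> 'I_(k ^ 2).+1}|.
  rewrite -cardsT => ltB; have /subsetPn[p _ pNB] : ~~ ([set: {ffun T -> 'I_(k ^ 2).+1}] \subset B).
    by apply: contraL ltB => /subset_leq_card; rewrite -leqNgt.
  exists p => x y xX yX bigxy; apply: contra pNB => pbad.
  by apply/bigcupP; exists (x, y) => //; rewrite !inE xX yX.
have leP : #|P| <= k ^ 2.
  apply: leq_trans (_ : #|setX X X| <= _); last by rewrite cardsX -mulnn leq_mul.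
  by apply: subset_leq_card; apply/subsetP=> xy; rewrite inE => /andP[].
rewrite -(ltn_pmul2r (ltn0Sn (k ^ 2))).
apply: (@leq_ltn_trans (k ^ 2 * #|{ffun T -> 'I_(k ^ 2).+1}|)); last first.
  rewrite mulnC ltn_pmul2l //; apply/card_gt0P; by exists [ffun=> ord0].
apply: (@leq_trans (\sum_(xy in P) #|{ffun T -> 'I_(k ^ 2).+1}|)); last first.
  by rewrite sum_nat_const leq_mul2r leP orbT.
apply: (@leq_trans ((\sum_(xy in P) #|bad xy.1 xy.2|) * (k ^ 2).+1)).
  by rewrite leq_mul2r card_bigcup_le_sum orbT.
rewrite big_distrl /=; apply: leq_sum => xy; rewrite !inE => /andP[/andP[xX yX] bigxy].
exact: card_bad.
Qed.

End Blocks.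

(** The constant 7 comes from the blocks: [k ^ 4 * (2 * k ^ 2 + 1)] vertices for at most
[k ^ 4] blocks, doubled since only one of the two sides of the symmetric
difference need be large, plus [k ^ 2] for the vertices of [U]. *)
Lemma separate_far (far : rel T) :
    {in X &, forall x y, far x y -> 7 * k ^ 6 <= dist x y} ->
  exists2 S : {set T}, [disjoint S & U] &
    {in X &, forall x y, far x y -> deg S x + k ^ 2 < deg S y \/ deg S y + k ^ 2 < deg S x}.
Proof.
move=> far_dist; have [Q [QA Qdis]] := exists_blocks.
have [p good] := exists_good_blocks QA Qdis.
exists (block_union Q p).
  rewrite disjoint_sym; apply/bigcup_disjointP=> j /andP[/QA[QjA _] _].
  by rewrite disjoint_sym; apply: disjointWl QjA _; rewrite disjoints_subset /A setDE subsetIr.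
move=> x y xX yX /(far_dist _ _ xX yX) farxy.
have goodN u v : u \in X -> v \in X -> big u v ->
    deg (block_union Q p) u + k ^ 2 < deg (block_union Q p) v \/
    deg (block_union Q p) v + k ^ 2 < deg (block_union Q p) u.
  by move=> uX vX /(good u v uX vX); rewrite inE negb_and -!ltnNge => /orP[]; [right|left].
have [|bigxy|bigyx] := @private_nbrs_large U x y (k ^ 4 * (2 * k ^ 2).+1).
- apply: leq_trans farxy; apply: leq_trans (leq_add (leqnn _) leU) _.
  have : 0 < k ^ 2 by rewrite expn_gt0 k_gt0.
  rewrite (expnM k 2 2) (expnM k 2 3); nia.
- exact: goodN.
- by have [] := goodN y x yX xX bigyx; [right | left].
Qed.

End Separation.

(** * Clusters *)

Section Clusters.

Variables (T : finType) (e : rel T).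
Implicit Types (u v w x y : T) (S X W : {set T}).

Local Notation deg := (induced_degree e).
Local Notation dist := (dist e).

Lemma deg_gap S W g x y : [disjoint S & W] -> #|W| <= g ->
  deg S x + g < deg S y -> deg (S :|: W) x < deg (S :|: W) y.
Proof. by move=> dis leW; rewrite !degU //; have := deg_le e W x; lia. Qed.

Lemma far_family_degrees k X : 0 < k -> #|X| = k ->
    {in X &, forall x y, x != y -> 7 * k ^ 6 <= dist x y} ->
  k <= max_distinct_degrees e.
Proof.
move=> k_gt0 cX farX.
have leX : #|X| <= k ^ 2 by rewrite cX; nia.
have [S disS gapS] := @separate_far _ e k X X k_gt0 (eq_leq cX) leX _ farX.
apply: (@deg_in_max _ _ _ (S :|: X) X); rewrite ?subsetUr ?cX //.
  have /card_gt0P[x xX] : 0 < #|X| by rewrite cX.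
  by apply/set0Pn; exists x; rewrite inE xX orbT.
move=> x y xX yX eq_deg; apply: contraTeq (leqnn (deg (S :|: X) x)) => neq_xy.
have [lt_xy|lt_yx] := gapS x y xX yX neq_xy.
  by have := deg_gap disS leX lt_xy; rewrite eq_deg ltnn.
by have := deg_gap disS leX lt_yx; rewrite eq_deg ltnn.
Qed.

Definition separated F X := [forall x in X, forall y in X, (x != y) ==> (F <= dist x y)].

Lemma separatedP F X :
  reflect {in X &, forall x y, x != y -> F <= dist x y} (separated F X).
Proof.
apply: (iffP forall_inP) => [sepX x y xX yX|sepX x xX].
  by move=> neq_xy; have /forall_inP/(_ y yX)/implyP-> := sepX x xX.
by apply/forall_inP=> y yX; apply/implyP/sepX.
Qed.

Lemma max_separated_covers F X x : 0 < F -> maxset (separated F) X ->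
  exists2 c, c \in X & dist x c < F.
Proof.
move=> F_gt0 /maxsetP[/separatedP sepX maxX].
have [xX|xNX] := boolP (x \in X); first by exists x; rewrite ?dist_refl.
apply/exists_inP; apply: contraNT xNX; rewrite negb_exists_in => /forall_inP far_x.
rewrite -(maxX (x |: X)) ?subsetUr ?setU11 //.
apply/separatedP=> u v /setU1P[->|uX] /setU1P[->|vX] neq; first by rewrite eqxx in neq.
- by rewrite leqNgt far_x.
- by rewrite dist_sym leqNgt far_x.
- exact: sepX.
Qed.

Lemma dist_path d (r : rel T) x p : (forall u v, r u v -> dist u v <= d) ->
  path r x p -> dist x (last x p) <= size p * d.
Proof.
move=> r_le; elim: p x => [|y p IH] x /=; first by rewrite dist_refl.
case/andP=> /r_le le_xy /IH le_y; rewrite mulSn.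
exact: leq_trans (dist_triangle e y _ _) (leq_add le_xy le_y).
Qed.

(** A simple path has at most [#|X|] vertices, hence at most [#|X|.-1] edges. *)
Lemma dist_connect d (r : rel T) X x y : (forall u v, r u v -> dist u v <= d) ->
    (forall u v, r u v -> v \in X) -> x \in X ->
  connect r x y -> dist x y <= #|X|.-1 * d.
Proof.
move=> r_le rX xX /connectP[p /shortenP[q r_q uniq_q _] ->].
apply: leq_trans (dist_path r_le r_q) _; rewrite leq_mul2r; apply/orP; right.
rewrite -ltnS prednK; last by apply/card_gt0P; exists x.
rewrite -[(size q).+1]/(size (x :: q)) -(card_uniqP uniq_q); apply: subset_leq_card.
apply/subsetP=> z; rewrite in_cons => /predU1P[-> //|].
elim: q x r_q {uniq_q xX} => // a q IH x /= /andP[/rX aX /IH zq].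
by rewrite in_cons => /predU1P[-> //|].
Qed.

(** The clusters are the classes of vertices whose nearest points in a maximal
separated set [C] are linked, two points of [C] being linked when they are at
distance at most [3 * F]: then close vertices have linked nearest points. The map
[pi] sends a vertex to a representative of its cluster. The bound [3 * F * m] is
[2 * F] for reaching [C] from both ends plus [3 * F] for each of at most [m - 1]
links. *)
Lemma exists_clusters F m : 0 < F ->
    (forall X, {in X &, forall x y, x != y -> F <= dist x y} -> #|X| <= m) ->
  exists pi : T -> T,
    [/\ forall x, pi (pi x) = pi x,
        forall x y, pi x = pi y -> dist x y <= 3 * F * m,
        forall x y, pi x != pi y -> F <= dist x y
      & #|pi @: [set: T]| <= m].
Proof.
move=> F_gt0 sep_le.
have [C maxC] : {C | maxset (separated F) C}.
  by apply: ex_maxset; exists set0; apply/separatedP=> x y; rewrite inE.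
have [/separatedP sepC _] := maxsetP maxC.
have leC := sep_le C sepC.
have near_ex x : {c | (c \in C) && (dist x c < F)}.
  by apply: sigW; have [c cC ltc] := max_separated_covers x F_gt0 maxC; exists c; rewrite cC.
pose near x := sval (near_ex x).
have nearC x : near x \in C by case/andP: (svalP (near_ex x)).
have near_lt x : dist x (near x) < F by case/andP: (svalP (near_ex x)).
have near_id c : c \in C -> near c = c.
  by move=> cC; apply: contraTeq (near_lt c) => neq; rewrite -leqNgt sepC // eq_sym.
pose r c d := [&& c \in C, d \in C & dist c d <= 3 * F].
have r_sym : connect_sym r.
  by apply: sym_connect_sym => c d; rewrite /r dist_sym andbCA.
have rootC c : c \in C -> root r c \in C.
  move=> cC; have /connectP[p r_p ->] := connect_root r c.
  elim: p c cC r_p => //= d p IH c cC /andP[/and3P[_ dC _]]; exact: IH.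
exists (fun x => root r (near x)); split.
- by move=> x; rewrite near_id ?rootC // root_root.
- move=> x y /eqP; rewrite root_connect // => conn.
  have le_near : dist (near x) (near y) <= #|C|.-1 * (3 * F).
    by apply: dist_connect conn => // u v /and3P[].
  have C_gt0 : 0 < #|C| by apply/card_gt0P; exists (near x).
  have := near_lt x; have := near_lt y.
  have := dist_triangle e (near x) x y; have := dist_triangle e (near y) (near x) y.
  rewrite (dist_sym e y); nia.
- move=> x y; apply: contraNT; rewrite -ltnNge => lt_xy.
  rewrite root_connect //; apply: connect1; rewrite /r !nearC /=.
  have := near_lt x; have := near_lt y.
  have := dist_triangle e x (near x) (near y); have := dist_triangle e y x (near y).
  rewrite (dist_sym e (near x) x); lia.
- apply: leq_trans leC; apply: subset_leq_card; apply/subsetP=> _ /imsetP[x _ ->].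
  exact: rootC.
Qed.

End Clusters.

(** * Sparsity inside a cluster *)

Section Sparse.

Variables (T : finType) (e : rel T).
Hypotheses (e_sym : symmetric e) (e_irr : irreflexive e).
Implicit Types (u v w x y : T) (C D I : {set T}) (b : bool).

Local Notation dist := (dist e).

(** For [b = false] the vertex [v] itself is counted when it lies in [C]; this makes
the sets for the two values of [b] complementary in [C]. *)
Definition bnbrs b C v := [set w in C | e v w == b].

Lemma card_bnbrs_sum b C v : #|bnbrs b C v| = \sum_(w in C) (e v w == b).
Proof.
rewrite -sum1_card /bnbrs big_mkcond [RHS]big_mkcond; apply: eq_bigr => w _.
by rewrite inE; case: (w \in C); case: eqP.
Qed.

Lemma card_bnbrs_close b C u v : #|bnbrs b C v| <= #|bnbrs b C u| + dist u v.
Proof.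
apply: leq_trans (leq_card_setU _ _); apply: subset_leq_card; apply/subsetP=> w.
by rewrite !inE; case: (w \in C); case: (e u w); case: (e v w); case: b.
Qed.

(** Let [P] and [Q] be the neighbours and the other vertices of [C] with respect to
[v].  Every pair in [P * Q] is either an edge, where its end in [P] disagrees with
[v], or a non-edge, where its end in [Q] disagrees with [v].  Each vertex
disagrees with [v] at most [d] times, so [#|P| * #|Q| <= (#|P| + #|Q|) * d] and the
smaller of the two sets has at most [2 * d] elements. *)
Lemma cluster_sparse C d v : v \in C -> {in C &, forall x y, dist x y <= d} ->
  exists b, #|bnbrs b C v| <= 2 * d /\ {in C, forall u, #|bnbrs b C u| <= 3 * d}.
Proof.
move=> vC close; set P := bnbrs true C v; set Q := bnbrs false C v.
suff [b leb] : exists b, #|bnbrs b C v| <= 2 * d.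
  exists b; split=> // u uC; have := card_bnbrs_close b C v u; have := close v u vC uC; lia.
have leP p : p \in P -> #|bnbrs true Q p| <= d.
  rewrite inE => /andP[pC _]; apply: leq_trans (close v p vC pC).
  by apply: subset_leq_card; apply/subsetP=> w; rewrite !inE -andbA => /and3P[_ /eqP-> /eqP->].
have leQ q : q \in Q -> #|bnbrs false P q| <= d.
  rewrite inE => /andP[qC _]; apply: leq_trans (close v q vC qC).
  by apply: subset_leq_card; apply/subsetP=> w; rewrite !inE -andbA => /and3P[_ /eqP-> /eqP->].
have lePQ : #|P| * #|Q| <= (#|P| + #|Q|) * d.
  apply: (@leq_trans (\sum_(p in P) #|bnbrs true Q p| +
                      \sum_(q in Q) #|bnbrs false P q|)); last first.
    by rewrite mulnDl leq_add // -sum_nat_const leq_sum.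
  rewrite -sum_nat_const.
  under [X in _ <= X + _]eq_bigr do rewrite card_bnbrs_sum.
  under [X in _ <= _ + X]eq_bigr do rewrite card_bnbrs_sum.
  rewrite [X in _ + X]exchange_big -big_split; apply: leq_sum => p _.
  rewrite -big_split -sum1_card; apply: leq_sum => q _.
  by rewrite /= (e_sym q p); case: (e p q).
case: (leqP #|P| (2 * d)) => [|ltP]; first by exists true.
case: (leqP #|Q| (2 * d)) => [|ltQ]; first by exists false.
nia.
Qed.

(** Otherwise the neighbourhoods of a maximal independent set [I] cover [D] with sets
of size at most [t], while [I] is homogeneous and so has fewer than [n] elements.
Independence is meant in the graph or in its complement, depending on [b]. *)
Lemma exists_large_bdegree n b D t : hom_num e < n -> (n - 1) * t < #|D| ->
  exists2 x, x \in D & t <= #|bnbrs b D x :\ x|.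
Proof.
move=> lt_hom ltD; apply/exists_inP; apply: contraLR ltD.
rewrite negb_exists_in -leqNgt => /forall_inP degD.
pose indep I := [forall u in I, forall v in I, (u != v) ==> (e u v != b)].
have [I /maxsetP[/andP[ID indI] maxI]] : {I | maxset (fun I => (I \subset D) && indep I) I}.
  by apply: ex_maxset; exists set0; rewrite sub0set; apply/forall_inP=> x; rewrite inE.
have indP u v : u \in I -> v \in I -> u != v -> e u v != b.
  by move=> uI vI; have /forall_inP/(_ v vI)/implyP := forall_inP indI u uI.
have leI : #|I| <= n - 1.
  suff : #|I| <= hom_num e by lia.
  apply: (@leq_bigmax_cond _ (homogeneous e) (fun U : {set T} => #|U|)); rewrite /homogeneous.
  case: (b) indP => indP; apply/orP; [right | left];
    apply/forall_inP=> u uI; apply/forall_inP=> v vI.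
    by have [->|/(indP u v uI vI)] := eqVneq u v; [rewrite e_irr | case: (e u v)].
  by apply/implyP => /(indP u v uI vI); case: (e u v).
have subD : D \subset \bigcup_(v in I) (v |: bnbrs b D v).
  apply/subsetP=> x xD; apply: contraT => xN; have xNI v : v \in I -> (x != v) && (e v x != b).
    move=> vI; apply: contraR xN; rewrite negb_and !negbK => vx.
    by apply/bigcupP; exists v => //; rewrite !inE xD.
  have xI : x \notin I by apply/negP=> /xNI; rewrite eqxx.
  rewrite -(maxI (x |: I)) ?setU11 ?subsetUr // in xI.
  rewrite subUset sub1set xD ID; apply/forall_inP=> u uI; apply/forall_inP=> v vI.
  apply/implyP; move: uI vI => /setU1P[->|uI] /setU1P[->|vI] neq.
  - by rewrite eqxx in neq.
  - by rewrite e_sym; case/andP: (xNI v vI).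
  - by case/andP: (xNI u uI).
  - exact: indP.
apply: leq_trans (subset_leq_card subD) _; apply: leq_trans (card_bigcup_le_sum _ _ _) _.
apply: (@leq_trans (\sum_(v in I) t)); last by rewrite sum_nat_const leq_mul2r leI orbT.
apply: leq_sum => v vI; rewrite cardsU1 -ltnS.
have := degD v (subsetP ID v vI); rewrite -ltnNge (cardsD1 v (bnbrs b D v)).
by case: (v \in bnbrs b D v) => /=; lia.
Qed.

End Sparse.

(** * Labels and gadgets *)

Section Labels.

Variables (T : finType) (pi : T -> T).
Implicit Types (i : T) (s : seq T).

Definition cluster i := [set x | pi x == i].

Lemma card_clusters_le c b s :
    (forall i, #|cluster i| <= c * count_mem i s + b) ->
  #|T| <= c * size s + #|pi @: [set: T]| * b.
Proof.
move=> le_cl.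
have -> : #|T| = \sum_(i in pi @: [set: T]) #|cluster i|.
  rewrite -cardsT -sum1_card (partition_big pi (mem (pi @: [set: T]))) /=.
    apply: eq_bigr => i _; rewrite -sum1_card; apply: eq_bigl => x.
    by rewrite !inE.
  by move=> x _; apply: imset_f.
apply: (@leq_trans (\sum_(i in pi @: [set: T]) (c * count_mem i s + b))).
  by apply: leq_sum => i _.
rewrite big_split /= sum_nat_const leq_add2r -big_distrr /= leq_mul2l.
apply/orP; right; have <- : \sum_i count_mem i s = size s.
  elim: s {le_cl} => [|j s IH] /=; first by rewrite big1.
  rewrite big_split /= IH (bigD1 j) //= eqxx big1 // => i ij.
  by rewrite eq_sym (negPf ij).
by rewrite big_mkcond; apply: leq_sum => i _; case: ifP.
Qed.

(** Labels are added one at a time; the hypothesis says that as long as fewer than [q]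
labels have been placed, some cluster still has room for one more. *)
Lemma exists_labels c b q :
    (forall p, p < q -> c * p + #|pi @: [set: T]| * b < #|T|) ->
  exists2 s, size s = q & {in s, forall i, c * (count_mem i s).-1 + b < #|cluster i|}.
Proof.
elim: q => [|q IH] big; first by exists [::].
have [p lt_pq|s szs s_ok] := IH; first by rewrite big // ltnW.
have [/existsP[i lt_i]|] := boolP [exists i, c * count_mem i s + b < #|cluster i|].
  exists (i :: s) => [|j]; rewrite /= ?szs // in_cons.
  by have [->|ji] := eqVneq j i => // /s_ok.
rewrite negb_exists => /forallP le_cl.
have := big q (ltnSn q); rewrite -szs ltnNge card_clusters_le // => i.
by rewrite leqNgt.
Qed.

Lemma exists_rich_label c s : c * size s < #|T| ->
  exists i, c * count_mem i s < #|cluster i|.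
Proof.
move=> ltT; apply/existsP; apply: contraLR ltT.
rewrite negb_exists -leqNgt => /forallP le_cl.
rewrite -[leqRHS]addn0 -[X in _ + X](muln0 #|pi @: [set: T]|).
by apply: card_clusters_le => i; rewrite addn0 leqNgt.
Qed.

End Labels.

Section Gadgets.

Variables (T : finType) (e : rel T) (pi : T -> T) (bit : T -> bool).
Hypotheses (e_sym : symmetric e) (e_irr : irreflexive e) (pi_id : forall x, pi (pi x) = pi x).
Implicit Types (x y i : T) (g h : T * {set T}) (L M : seq (T * {set T})).

Local Notation dist := (dist e).
Local Notation cluster := (cluster pi).

(** In a gadget [g = (x, Y)] the vertex [x] belongs to the induced subgraph, and [Y]
is a reservoir of vertices that may be added to it in order to move the degree
of [x].  The value [bit i] tells which of the two graphs, [e] or its complement, is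
sparse in the cluster represented by [i]. *)
Definition used L := \bigcup_(g <- L) (g.1 |: g.2).

(** Earlier vertices are compared with the representatives of their clusters.  This
costs one distance [d] for each of them, instead of one for each pair, and it
makes vertices of the same cluster agree on [g.2].  In the cluster of [g] it shows
that the earlier vertices see [g.2] in the opposite way to [g.1]. *)
Definition fits L g :=
  [/\ g.1 \notin used L,
      [disjoint g.2 & used L],
      g.1 \notin g.2,
      {in g.2, forall y, e g.1 y = bit (pi g.1) /\ e (pi g.1) y = ~~ bit (pi g.1)}
    & {in L, forall h, {in g.2, forall y, e h.1 y = e (pi h.1) y}}].

Fixpoint chain L M := if M is g :: M' then fits L g /\ chain (g :: L) M' else True.

Lemma used_cons g L : used (g :: L) = (g.1 |: g.2) :|: used L.
Proof. by rewrite /used big_cons. Qed.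

Lemma mem_used g L x : g \in L -> x \in g.1 |: g.2 -> x \in used L.
Proof. by move=> gL xg; rewrite /used (big_rem g gL) inE xg. Qed.

Lemma card_used_le L m : {in L, forall g, #|g.2| < m} -> #|used L| <= size L * m.
Proof.
move=> lt_m; apply: leq_trans (card_bigcup_le_sum _ _ _) _.
elim: L lt_m => [|g L IH] lt_m; first by rewrite big_nil.
rewrite big_cons /= mulSn leq_add ?IH //; last first.
  by move=> h hL; rewrite lt_m // in_cons hL orbT.
by rewrite cardsU1; have := lt_m g (mem_head _ _); case: (_ \notin _); lia.
Qed.

Lemma chain_disjoint L M g : chain L M -> g \in M -> [disjoint g.2 & used L].
Proof.
elim: M L => //= h M IH L [[_ disL _ _ _] chM]; rewrite in_cons => /predU1P[->//|/(IH _ chM)].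
by apply: disjointWr; rewrite used_cons subsetUr.
Qed.

Definition neat L := uniq [seq g.1 | g <- L] /\ {in L &, forall g h, g.1 \notin h.2}.

Lemma neat_cons L g : fits L g -> neat L -> neat (g :: L).
Proof.
move=> [gNL disL gNg _ _] [uL nL]; split=> /=.
  rewrite uL andbT; apply: contra gNL => /mapP[h hL ->].
  by apply: mem_used hL _; rewrite setU11.
move=> h k; rewrite !in_cons => /predU1P[->|hL] /predU1P[->|kL] //.
- by apply: contra gNL => gk; apply: mem_used kL _; rewrite inE gk orbT.
- apply/negP=> hg; have := disjointFr disL hg.
  by rewrite (mem_used hL) // setU11.
- exact: nL.
Qed.

Lemma neat_catrev L M : chain L M -> neat L -> neat (catrev M L).
Proof. by elim: M L => //= g M IH L [fitg chM] nL; apply: IH => //; apply: neat_cons. Qed.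

Section Extension.

Variables (n d k : nat).
Hypotheses (lt_hom : hom_num e < n)
  (close : forall x y, pi x = pi y -> dist x y <= d)
  (sparse : forall i, pi i = i -> #|bnbrs e (bit i) (cluster i) i| <= 2 * d).

(** The cluster still has more than [(n - 1) * t] vertices after removal of the set [B]
of all vertices that would violate [fits].  These are the used ones, those
distinguishing an earlier vertex from its representative, and the few sparse
neighbours of the representative [i].  The set [E] is an additional restriction
on the vertex of the gadget. *)
Lemma exists_gadget L i t (E : {set T}) : pi i = i ->
    (n - 1) * t + (#|used L| + #|E| + (size L + 2) * d) < #|cluster i| ->
  exists g, [/\ pi g.1 = i, #|g.2| = t, fits L g & g.1 \notin E].
Proof.
move=> pi_i big.
pose Z := \bigcup_(h <- L) [set y | e h.1 y != e (pi h.1) y].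
pose B := used L :|: E :|: (Z :|: bnbrs e (bit i) (cluster i) i).
have leZ : #|Z| <= size L * d.
  apply: leq_trans (card_bigcup_le_sum _ _ _) _.
  elim: (L) => [|h L' IH]; first by rewrite big_nil.
  by rewrite big_cons /= mulSn leq_add //; apply: close; rewrite pi_id.
have leB : #|B| <= #|used L| + #|E| + (size L + 2) * d.
  apply: leq_trans (leq_card_setU _ _) (leq_add (leq_card_setU _ _) _).
  by apply: leq_trans (leq_card_setU _ _) _; rewrite mulnDl leq_add ?sparse.
have [|x] := @exists_large_bdegree _ e e_sym e_irr n (bit i) (cluster i :\: B) t lt_hom.
  by rewrite cardsD; have := subset_leq_card (subsetIr (cluster i) B); lia.
rewrite !inE !negb_or => /andP[/andP[/andP[xL xE] _] /eqP pi_x] /subset_of_card[Y YN cY].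
have Yprop y : y \in Y ->
    [/\ y != x, y \in cluster i, y \notin used L, y \notin Z & e x y = bit i /\ e i y = ~~ bit i].
  move=> /(subsetP YN); rewrite !inE !negb_or => /andP[yx /andP[/andP[/andP[yB yZbi] yi] /eqP xy]].
  move: yB yZbi => /andP[yL _] /andP[yZ ybi].
  by split=> //; split=> //; move: ybi; rewrite yi /=; case: (e i y); case: (bit i).
exists (x, Y); split=> //; split=> //=.
- by apply/pred0P=> y /=; apply/andP=> -[/Yprop[_ _ /negP]].
- by apply/negP=> /Yprop[]; rewrite eqxx.
- by move=> y /Yprop[_ _ _ _]; rewrite pi_x.
- move=> h hL y /Yprop[_ _ _ yZ _]; apply/eqP; apply: contraR yZ => neq.
  by rewrite /Z (big_rem h hL) !inE neq.
Qed.

Lemma exists_chain (t : T -> nat) (r : seq T) L :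
    {in r, forall i, [/\ pi i = i, t i < k
                       & (n - 1) * t i + (k * k + (k + 2) * d) < #|cluster i|]} ->
    {in L, forall g, #|g.2| < k} -> size L + size r <= k ->
  exists2 M, chain L M & [seq pi g.1 | g <- M] = r /\ {in M, forall g, #|g.2| = t (pi g.1)}.
Proof.
elim: r L => [|i r IH] L ok_r small_L le_k; first by exists [::].
have [pi_i ti_k big_i] := ok_r i (mem_head _ _).
have [|g [pi_g cg fit_g _]] := @exists_gadget L i (t i) set0 pi_i.
  apply: leq_ltn_trans big_i; rewrite leq_add2l cards0 addn0 leq_add ?leq_mul2r //=.
    apply: leq_trans (card_used_le small_L) _; rewrite leq_mul2r; move: le_k => /=; lia.
  by apply/orP; right; move: le_k => /=; lia.
have [j jr|h|| M chM [labM sizeM]] := IH (g :: L).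
- by apply: ok_r; rewrite in_cons jr orbT.
- by rewrite in_cons => /predU1P[->|/small_L//]; rewrite cg.
- by move: le_k => /=; lia.
exists (g :: M); split=> //=; first by rewrite labM pi_g.
by move=> h; rewrite in_cons => /predU1P[->|/sizeM//]; rewrite cg pi_g.
Qed.

End Extension.

End Gadgets.

(** * Tuning the degrees inside clusters *)

Section Tuning.

Variables (T : finType) (e : rel T) (pi : T -> T) (bit : T -> bool).
Implicit Types (x y u v : T) (H A E : {set T}) (g h : T * {set T}) (L M : seq (T * {set T})).

Local Notation deg := (induced_degree e).
Local Notation fits := (fits e pi bit).
Local Notation chain := (chain e pi bit).

Definition same_cluster g h := pi h.1 == pi g.1.

Lemma fits_bit L g h y : fits L g -> h \in L -> same_cluster g h -> y \in g.2 ->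
  e h.1 y = ~~ bit (pi g.1).
Proof.
by move=> [_ _ _ own old] hL /eqP same yg; rewrite (old h hL y yg) same; case: (own y yg).
Qed.

(** Additions from a later reservoir leave the differences between earlier degrees
inside a cluster unchanged. *)
Lemma deg_add_same L g H A h h' : fits L g -> A \subset g.2 -> [disjoint H & g.2] ->
    h \in L -> h' \in L -> pi h.1 = pi h'.1 ->
  deg (H :|: A) h.1 + deg H h'.1 = deg (H :|: A) h'.1 + deg H h.1.
Proof.
move=> [_ _ _ _ old] Ag disH hL h'L same.
rewrite !degU ?(disjointWr Ag) // (@deg_eq _ e A h.1 h'.1); first by lia.
by move=> y /(subsetP Ag) yg; rewrite (old h) // (old h') // same.
Qed.

(** Adding [s] vertices from the reservoir of [g] would give [g.1] the same degree as
the vertex [v] of its cluster: in the sparse graph the degree of [g.1] goes up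
by [s], and in the complementary case it is that of [v] which goes up. *)
Definition clash g H s v :=
  if bit (pi g.1) then deg H g.1 + s == deg H v else deg H v + s == deg H g.1.

Lemma clash_gap g H c u v s t : deg H u + c < deg H v -> s <= c -> t <= c ->
  clash g H s u -> clash g H t v -> False.
Proof. by rewrite /clash; case: (bit _) => ? ? ? /eqP ? /eqP ?; lia. Qed.

Lemma tune_one L g H E : fits L g -> [disjoint H & g.2] -> #|E| <= #|g.2| ->
    {in L, forall h, same_cluster g h ->
       h.1 \in E \/ forall s, s <= #|g.2| -> ~~ clash g H s h.1} ->
  exists2 A : {set T}, A \subset g.2 &
    {in L, forall h, same_cluster g h -> deg (H :|: A) h.1 != deg (H :|: A) g.1}.
Proof.
move=> fit_g disH leE cover.
have [|s les sE] := @avoid_few T (clash g H) E #|g.2| _ leE.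
  by rewrite /clash; case: (bit _) => v s t _ _ _ /eqP ? /eqP ?; lia.
have [A Ag cA] := subset_of_card les; exists A => // h hL same.
have {cover sE} noclash : ~~ clash g H s h.1.
  by have [/sE|/(_ s les)] := cover h hL same.
have [_ _ _ own _] := fit_g.
rewrite !degU ?(disjointWr Ag) //.
rewrite (@deg_all _ e A h.1 (~~ bit (pi g.1))); last first.
  by move=> y /(subsetP Ag); apply: fits_bit hL same.
rewrite (@deg_all _ e A g.1 (bit (pi g.1))); last by move=> y /(subsetP Ag)/own[].
move: noclash; rewrite /clash cA; case: (bit _) => /=; apply: contraNneq; lia.
Qed.

Definition resolved H L :=
  {in L &, forall g h, g.1 != h.1 -> same_cluster g h -> deg H g.1 != deg H h.1}.

(** The number of vertices of the cluster of [g] counted over all gadgets is at most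
the number [#|g.2|.+1] of available degrees, or it exceeds it by one and two
degrees of that cluster are too far apart to be both hit by [g]. *)
Definition roomy H L M g :=
  count (same_cluster g) L + count (same_cluster g) M <= #|g.2|.+1 \/
  count (same_cluster g) L + count (same_cluster g) M <= #|g.2|.+2 /\
  exists u v : T * {set T}, [/\ u \in L, v \in L, same_cluster g u, same_cluster g v
                & deg H u.1 + #|g.2| < deg H v.1].

(** In the second case of [roomy] one of the two distant vertices clashes with no
choice for [g], and it can be dropped from the list of vertices to avoid. *)
Lemma roomy_cover L M g H : roomy H L (g :: M) g ->
  exists2 E : {set T}, #|E| <= #|g.2| &
    {in L, forall h, same_cluster g h ->
       h.1 \in E \/ forall s, s <= #|g.2| -> ~~ clash g H s h.1}.
Proof.
pose E := [set x in [seq h.1 | h <- L & same_cluster g h]].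
have leE : #|E| <= count (same_cluster g) L.
  by rewrite cardsE (leq_trans (card_size _)) // size_map size_filter.
have memE h : h \in L -> same_cluster g h -> h.1 \in E.
  by move=> hL same; rewrite inE map_f // mem_filter same.
have sgg : same_cluster g g by apply: eqxx.
rewrite /roomy /= sgg => -[le_room|[le_room [u [v [uL vL su sv gap]]]]].
  by exists E => [|h hL same]; [lia | left; exact: memE].
have drop (w : T * {set T}) : w \in L -> same_cluster g w ->
    (forall s, s <= #|g.2| -> ~~ clash g H s w.1) ->
    exists2 E : {set T}, #|E| <= #|g.2| &
    {in L, forall h, same_cluster g h ->
       h.1 \in E \/ forall s, s <= #|g.2| -> ~~ clash g H s h.1}.
  move=> wL sw free; exists (E :\ w.1) => [|h hL same].
    by have := cardsD1 w.1 E; rewrite memE //; lia.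
  have [->|neq] := eqVneq h.1 w.1; first by right.
  by left; rewrite !inE neq map_f // mem_filter same.
have [/forallP free|] := boolP [forall s : 'I_#|g.2|.+1, ~~ clash g H s u.1].
  by apply: (drop u) => // s; rewrite -ltnS => lts; apply: (free (Ordinal lts)).
rewrite negb_forall => /existsP[s]; rewrite negbK => clash_u.
apply: (drop v) => // t let_; apply/negP=> clash_v.
by apply: clash_gap gap _ let_ clash_u clash_v; rewrite -ltnS.
Qed.

(** The gadgets are tuned in the order in which they were chosen.  A later vertex may
well distinguish vertices in the reservoir of an earlier gadget, but its own
degree is settled only afterwards. *)
Lemma tune_chain L M H : chain L M -> {in M, forall g, [disjoint H & g.2]} ->
    resolved H L -> {in M, forall g, roomy H L M g} ->
  exists2 A : {set T}, A \subset used M & resolved (H :|: A) (catrev M L).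
Proof.
elim: M L H => [|g M IH] L H /=.
  by exists set0; rewrite ?sub0set // setU0.
move=> [fit_g chM] disH res room.
have disg := disH g (mem_head _ _).
have [E leE cover] := roomy_cover (room g (mem_head _ _)).
have [A Ag distinct] := tune_one fit_g disg leE cover.
have keep h h' := @deg_add_same L g H A h h' fit_g Ag disg.
have [h hM|h h' hL h'L neq same|h hM|A' A'M res'] := IH (g :: L) (H :|: A) chM.
- rewrite -setI_eq0 setIUl; have hgM : h \in g :: M by rewrite in_cons hM orbT.
  have /eqP-> : H :&: h.2 == set0 by rewrite setI_eq0 disH.
  rewrite set0U setI_eq0 disjoint_sym; apply: disjointWr (chain_disjoint chM hM).
  by rewrite used_cons (subset_trans Ag) // -setUA subsetU // subsetUl orbT.
- move: hL h'L neq same; rewrite !in_cons => /predU1P[->|hL] /predU1P[->|h'L] neq same.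
  + by rewrite eqxx in neq.
  + by rewrite eq_sym distinct.
  + by rewrite distinct // /same_cluster eq_sym.
  + have := res h h' hL h'L neq same; have := keep h h' hL h'L (esym (eqP same)).
    by move=> eqk; apply: contra => /eqP eqd; apply/eqP; lia.
- have hgM : h \in g :: M by rewrite in_cons hM orbT.
  have [le_room|[le_room [u [v [uL vL su sv gap]]]]] := room h hgM.
    by left; move: le_room => /=; lia.
  right; split; first by move: le_room => /=; lia.
  exists u, v; split; rewrite ?in_cons ?uL ?vL ?orbT //.
  have /(keep u v uL vL) : pi u.1 = pi v.1 by rewrite (eqP su) (eqP sv).
  lia.
exists (A :|: A'); last by rewrite setUA.
rewrite used_cons subUset (subset_trans Ag) ?(subset_trans A'M) ?subsetUr //.
by rewrite -setUA subsetU // subsetUl orbT.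
Qed.

End Tuning.

(** * Assembly *)

Section Assembly.

Variables (T : finType) (e : rel T) (pi : T -> T) (bit : T -> bool).
Hypotheses (e_sym : symmetric e) (e_irr : irreflexive e) (pi_id : forall x, pi (pi x) = pi x).
Implicit Types (x y u v i : T) (H A B E S X Y : {set T}).
Implicit Types (g h : T * {set T}) (L M : seq (T * {set T})).

Local Notation dist := (dist e).
Local Notation deg := (induced_degree e).
Local Notation cluster := (cluster pi).
Local Notation fits := (fits e pi bit).
Local Notation chain := (chain e pi bit).
Local Notation resolved := (resolved e pi).
Local Notation roomy := (roomy e pi).

Lemma used_sub L M : {subset L <= M} -> used L \subset used M.
Proof.
elim: L => [|g L IH] LM; first by rewrite /used big_nil sub0set.
rewrite used_cons subUset IH ?andbT => [|h hL]; last by rewrite LM // in_cons hL orbT.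
by apply/subsetP=> x; apply: mem_used; rewrite LM ?mem_head.
Qed.

(** Once the gadgets are known, [S] is chosen outside all of their vertices, then the
initial gadgets [L] are set by hand through the last hypothesis, and the others
are tuned. Everything that is added to [S] lies in a set of at most [k ^ 2]
vertices, so it cannot close the gaps between different clusters. *)
Lemma many_degrees k L M : 0 < k -> size (catrev M L) = k ->
    neat L -> chain L M -> {in catrev M L, forall g, #|g.2| < k} ->
    (forall x y, pi x != pi y -> 7 * k ^ 6 <= dist x y) ->
    (forall H, {in L, forall g, [disjoint H & g.2]} ->
       exists A, [/\ A \subset used L, resolved (H :|: A) L
                   & {in M, forall g, roomy (H :|: A) L M g}]) ->
  k <= max_distinct_degrees e.
Proof.
move=> k_gt0 szLM neatL chM small far start.
have [uniqLM offLM] := neat_catrev chM neatL.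
have subL : {subset L <= catrev M L} by move=> g gL; rewrite catrevE mem_cat gL orbT.
have subM : {subset M <= catrev M L} by move=> g gM; rewrite catrevE mem_cat mem_rev gM.
pose X := [set x in [seq g.1 | g <- catrev M L]].
pose U := used (catrev M L).
have cX : #|X| = k by rewrite cardsE (card_uniqP uniqLM) size_map.
have leU : #|U| <= k ^ 2 by rewrite -mulnn -{1}szLM; apply: card_used_le.
have XU : X \subset U.
  by apply/subsetP=> x; rewrite inE => /mapP[g gLM ->]; rewrite (mem_used gLM) // setU11.
have Uoff g : g \in catrev M L -> g.2 \subset U.
  by move=> gLM; apply/subsetP=> x xg; rewrite (mem_used gLM) // inE xg orbT.
have [S disS gapS] := @separate_far _ e k X U k_gt0 (eq_leq cX) leU _ (fun x y _ _ => far x y).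
have disXS g : g \in catrev M L -> [disjoint X :|: S & g.2].
  move=> gLM; rewrite -setI_eq0 setIUl setU_eq0 !setI_eq0; apply/andP; split.
    rewrite disjoints_subset; apply/subsetP=> x; rewrite !inE => /mapP[h hLM ->].
    exact: offLM.
  exact: disjointWr (Uoff g gLM) disS.
have [g gL|A0 [A0L res0 room0]] := start (X :|: S); first exact/disXS/subL.
have [g gM|A AM res] := tune_chain chM _ res0 room0.
  rewrite -setI_eq0 setIUl setU_eq0 !setI_eq0 disXS ?subM //=.
  by rewrite disjoint_sym; apply: disjointWr A0L (chain_disjoint chM gM).
pose W := X :|: (A0 :|: A).
have WE : X :|: S :|: A0 :|: A = S :|: W by rewrite /W -!setUA setUCA.
rewrite {}WE in res.
have WU : W \subset U.
  rewrite !subUset XU (subset_trans A0L) ?(subset_trans AM) ?used_sub //.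
have leW : #|W| <= k ^ 2 := leq_trans (subset_leq_card WU) leU.
have disW : [disjoint S & W] := disjointWr WU disS.
apply: (@deg_in_max _ _ _ (S :|: W) X); rewrite ?cX //.
- by rewrite /W setUCA subsetUl.
- have /card_gt0P[x xX] : 0 < #|X| by rewrite cX.
  by apply/set0Pn; exists x; rewrite !inE in xX *; rewrite xX orbT.
move=> x y xX yX eq_xy; apply/eqP; apply: contraT => neq_xy.
have [same|diff] := eqVneq (pi y) (pi x).
  have [/mapP[g gLM eq_x] /mapP[h hLM eq_y]] : 
      x \in [seq g.1 | g <- catrev M L] /\ y \in [seq g.1 | g <- catrev M L].
    by rewrite !inE in xX yX.
  have := res g h gLM hLM; rewrite /same_cluster -eq_x -eq_y same eq_xy !eqxx.
  by move=> /(_ neq_xy isT).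
rewrite eq_sym in diff; have [lt_xy|lt_yx] := gapS x y xX yX diff.
  by have := deg_gap disW leW lt_xy; rewrite eq_xy ltnn.
by have := deg_gap disW leW lt_yx; rewrite eq_xy ltnn.
Qed.

(** The two sets push the difference of the two degrees in opposite directions, and the
one that widens the present difference is added.  A tie is resolved by [A], so
that [B] is used only when the difference is nonzero already, which makes up for
[B] being smaller by one. *)
Lemma force_gap H u v A (B : {set T}) b :
    {in A, forall y, e u y = b /\ e v y = ~~ b} ->
    {in B, forall y, e v y = b /\ e u y = ~~ b} ->
    [disjoint H & A] -> [disjoint H & B] -> #|A| = #|B|.+1 ->
  exists2 C : {set T}, C = A \/ C = B &
    deg (H :|: C) u + #|B| < deg (H :|: C) v \/ deg (H :|: C) v + #|B| < deg (H :|: C) u.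
Proof.
move=> Auv Bvu disA disB cA.
have degA : deg A u = b * #|A| /\ deg A v = ~~ b * #|A|.
  by split; apply: deg_all => y /Auv[].
have degB : deg B v = b * #|B| /\ deg B u = ~~ b * #|B|.
  by split; apply: deg_all => y /Bvu[].
have [le_A|lt_B] := boolP (if b then deg H v <= deg H u else deg H u <= deg H v).
  exists A; first by left.
  by case: b {Auv Bvu} degA degB le_A => -[? ?] [? ?] ?; rewrite !degU //; [right|left]; lia.
exists B; first by right.
by case: b {Auv Bvu} degA degB lt_B => -[? ?] [? ?] ?; rewrite !degU //; [left|right]; lia.
Qed.

Variables (n d k : nat).
Hypotheses (k_gt0 : 0 < k) (lt_hom : hom_num e < n)
  (close : forall x y, pi x = pi y -> dist x y <= d)
  (far : forall x y, pi x != pi y -> 7 * k ^ 6 <= dist x y)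
  (sparse : forall i, pi i = i -> #|bnbrs e (bit i) (cluster i) i| <= 2 * d /\
     {in cluster i, forall u, #|bnbrs e (bit i) (cluster i) u| <= 3 * d}).

(* Bound for the number of vertices that a gadget may have to avoid: those already
   used, at most [(k + 2) * d] by [fits], and at most [3 * k * d] for the
   additional restriction on the first gadget of the rich cluster. *)
Let budget := k * k + (4 * k + 3) * d.

Lemma sparse_root i : pi i = i -> #|bnbrs e (bit i) (cluster i) i| <= 2 * d.
Proof. by case/sparse. Qed.

(** The cluster [i] contains the gadget [g0] chosen without any restriction, whose
reservoir has as many elements as [i] has labels.  If there are none, then [g0] is
a single vertex and no other gadget comes from its cluster.  Otherwise [g0] and the first ordinary
gadget [g1] of the cluster are set by [force_gap], for which the vertex of [g1]
must not be a sparse neighbour of the reservoir of [g0]; whence the set [E]. *)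
Lemma many_degrees_of_labels s i :
    size s = k.-1 ->
    {in s, forall j, (n - 1) * (count_mem j s).-1 + budget < #|cluster j|} ->
    (n - 1) * count_mem i s < #|cluster i| ->
  k <= max_distinct_degrees e.
Proof.
move=> sz_s rich rich_i; set t := count_mem i s in rich_i.
have le_t j : count_mem j s < k by have := count_size (pred1 j) s; rewrite sz_s; lia.
have fixed j m : m < #|cluster j| -> pi j = j.
  by move=> lt_m; have /card_gt0P[x] := leq_ltn_trans (leq0n m) lt_m; rewrite inE => /eqP<-.
have pi_i := fixed i _ rich_i.
have [x0 x0C] := exists_large_bdegree e_sym e_irr (bit i) lt_hom rich_i.
case/subset_of_card=> Y0 Y0N cY0; pose g0 := (x0, Y0).
have pi_x0 : pi x0 = i by move: x0C; rewrite inE => /eqP.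
have Y0P y : y \in Y0 -> [/\ y != x0, pi y = i & e x0 y = bit i].
  by move=> /(subsetP Y0N); rewrite !inE => /and3P[-> /eqP-> /eqP->].
have neat0 : neat [:: g0].
  split=> // g h; rewrite !inE => /eqP-> /eqP->; apply/negP=> /Y0P[].
  by rewrite eqxx.
pose cap j := (count_mem j s).-1.
have labels r L : {subset r <= s} -> {in L, forall g, #|g.2| < k} -> size L + size r = k ->
  exists2 M, chain L M & [seq pi g.1 | g <- M] = r /\ {in M, forall g, #|g.2| = cap (pi g.1)}.
  move=> rs smallL szLr.
  apply: (exists_chain e_sym e_irr pi_id lt_hom close sparse_root) smallL (eq_leq szLr).
  move=> j /rs js; split; first exact: fixed (rich j js).
    exact: leq_ltn_trans (leq_pred _) (le_t _).
  by apply: leq_ltn_trans (rich j js); rewrite leq_add2l leq_add2l leq_mul2r; lia.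
have count_same M g : count (same_cluster pi g) M = count_mem (pi g.1) [seq pi h.1 | h <- M].
  by rewrite count_map.
have inM r M g : [seq pi h.1 | h <- M] = r -> g \in M -> pi g.1 \in r.
  by move=> <- gM; apply: (map_f (fun h => pi h.1)).
have small M L : {in M, forall g, #|g.2| = cap (pi g.1)} -> {in L, forall g, #|g.2| < k} ->
    {in catrev M L, forall g, #|g.2| < k}.
  move=> capM smallL g; rewrite catrevE mem_cat mem_rev => /orP[/capM->|/smallL//].
  exact: leq_ltn_trans (leq_pred _) (le_t _).
have small0 : {in [:: g0], forall g, #|g.2| < k}.
  by move=> g; rewrite inE => /eqP->; rewrite /= cY0 le_t.
have [iNs|i_s] := boolP (i \notin s).
  have sz0 : size [:: g0] + size s = k by rewrite /= sz_s; lia.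
  have [M chM [labM capM]] := labels s [:: g0] (fun=> id) small0 sz0.
  apply: (@many_degrees k [:: g0] M) => //.
  - by rewrite catrevE size_cat size_rev -(size_map (fun g => pi g.1)) labM addnC.
  - exact: small.
  move=> H _; exists set0; split; first exact: sub0set.
    by move=> g h; rewrite !inE => /eqP-> /eqP->; rewrite eqxx.
  move=> g gM; left; rewrite !count_same labM capM // /cap.
  have gs := inM s M g labM gM; have neq : pi g.1 != i by apply: contraNneq iNs => <-.
  by rewrite /= pi_x0 eq_sym (negPf neq); move: gs; rewrite -has_pred1 has_count; lia.
rewrite negbK in i_s.
have t_gt0 : 0 < t by rewrite -has_count has_pred1.
pose E := \bigcup_(y in Y0) bnbrs e (bit i) (cluster i) y.
have leE : #|E| <= k * (3 * d).
  apply: leq_trans (card_bigcup_le_sum _ _ _) _.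
  apply: (@leq_trans (\sum_(y in Y0) 3 * d)).
    apply: leq_sum => y /Y0P[_ pi_y _]; have [_] := sparse pi_i.
    by apply; rewrite inE pi_y.
  by rewrite sum_nat_const cY0 leq_mul2r ltnW ?orbT ?le_t.
have [|g1 [pi_g1 cg1 fit1 g1E]] := exists_gadget e_sym e_irr pi_id lt_hom close sparse_root
    (L := [:: g0]) (i := i) (t := t.-1) (E := E) pi_i.
  apply: leq_ltn_trans (rich i i_s); rewrite leq_add2l /budget /=.
  have := card_used_le small0; rewrite /=; nia.
have neat1 := neat_cons fit1 neat0.
have small1 : {in [:: g1; g0], forall g, #|g.2| < k}.
  move=> g; rewrite in_cons => /predU1P[->|/small0//].
  by rewrite cg1; have := le_t i; rewrite -/t; lia.
have sz1 : size [:: g1; g0] + size (rem i s) = k.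
  by have := size_rem i_s; have := count_size (pred1 i) s; rewrite /= -/t sz_s; lia.
have [M chM [labM capM]] := labels (rem i s) [:: g1; g0] (@mem_rem _ _ _) small1 sz1.
have sg01 : same_cluster pi g0 g1 by rewrite /same_cluster pi_g1 pi_x0.
apply: (@many_degrees k [:: g1; g0] M) => //.
- by rewrite catrevE size_cat size_rev -(size_map (fun g => pi g.1)) labM addnC.
- exact: small.
move=> H disH.
have [_ _ _ own1 old1] := fit1.
have AB0 : {in g0.2, forall y, e g0.1 y = bit i /\ e g1.1 y = ~~ bit i}.
  move=> y yY; have [_ pi_y xy] := Y0P y yY; split=> //.
  have : g1.1 \notin bnbrs e (bit i) (cluster i) y.
    by apply: contra g1E => g1y; apply/bigcupP; exists y.
  by rewrite !inE pi_g1 eqxx /= e_sym; case: (e _ y); case: (bit i).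
have AB1 : {in g1.2, forall y, e g1.1 y = bit i /\ e g0.1 y = ~~ bit i}.
  move=> y /[dup] /own1; rewrite pi_g1 => -[-> rooty] /(old1 _ (mem_head _ _)) ->.
  by rewrite /= pi_x0.
have cA : #|g0.2| = #|g1.2|.+1 by rewrite cg1 /= cY0 prednK.
have [A AE gap] := force_gap AB0 AB1 (disH _ (mem_last _ _)) (disH _ (mem_head _ _)) cA.
exists A; split.
- case: AE => ->; apply/subsetP=> y yA.
    by apply: (@mem_used _ g0); [rewrite !inE eqxx orbT | apply: setU1r].
  by apply: (@mem_used _ g1); [apply: mem_head | apply: setU1r].
- move=> g h; rewrite !inE => /orP[]/eqP-> /orP[]/eqP-> neq _; try by rewrite eqxx in neq.
    by apply/eqP; lia.
  by apply/eqP; lia.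
move=> g gM; rewrite /roomy !count_same labM capM // /cap.
have g_rem := inM _ M g labM gM; have gs := mem_rem g_rem.
have count_rem : count_mem (pi g.1) (rem i s) = count_mem (pi g.1) s - (pi g.1 == i).
  by rewrite count_rem /= eq_sym; case: (boolP (i \in s)) i_s => //=; rewrite mul1n.
have [eq_gi|neq_gi] := eqVneq (pi g.1) i; last first.
  left; rewrite count_rem /= pi_g1 pi_x0 eq_sym (negPf neq_gi).
  by move: gs; rewrite -has_pred1 has_count; lia.
right; rewrite count_rem /= pi_g1 pi_x0 eq_gi eqxx -/t; split; first by lia.
rewrite cg1 in gap; case: gap => gap; [exists g0, g1 | exists g1, g0].
  by split=> //; rewrite ?inE ?eqxx ?orbT // /same_cluster ?pi_g1 ?pi_x0 eq_gi.
by split=> //; rewrite ?inE ?eqxx ?orbT // /same_cluster ?pi_g1 ?pi_x0 eq_gi.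
Qed.

End Assembly.

Theorem theorem3 :
  exists2 K : nat, 0 < K &
    forall k n : nat, 0 < k -> 0 < n -> K * k ^ 9 <= n ->
    forall (T : finType) (e : rel T), symmetric e -> irreflexive e ->
      (n - 1) * (k - 1) < #|T| ->
      k <= max_distinct_degrees e \/ n <= hom_num e.
Proof.
exists 150 => // k n k_gt0 n_gt0 le_n T e e_sym e_irr ltT.
have [le_hom|lt_hom] := leqP n (hom_num e); first by right.
left; rewrite leqNgt; apply/negP=> few.
have sep_le (X : {set T}) : {in X &, forall x y, x != y -> 7 * k ^ 6 <= dist e x y} -> #|X| <= k.-1.
  move=> farX; rewrite -ltnS prednK // ltnNge; apply/negP=> /subset_of_card[Z ZX cZ].
  suff : k <= max_distinct_degrees e by rewrite leqNgt few.
  apply: far_family_degrees cZ _ => // x y xZ yZ.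
  by apply: farX; apply: (subsetP ZX).
have F_gt0 : 0 < 7 * k ^ 6 by rewrite muln_gt0 expn_gt0 k_gt0.
have [pi [pi_id close far leR]] := exists_clusters F_gt0 sep_le.
set d := 3 * (7 * k ^ 6) * k.-1 in close.
have [bit sparse] : exists bit : T -> bool, forall i, pi i = i ->
    #|bnbrs e (bit i) (cluster pi i) i| <= 2 * d /\
    {in cluster pi i, forall u, #|bnbrs e (bit i) (cluster pi i) u| <= 3 * d}.
  apply: (@fin_all_exists _ (fun=> bool) (fun i b => pi i = i ->
    #|bnbrs e b (cluster pi i) i| <= 2 * d /\
    {in cluster pi i, forall u, #|bnbrs e b (cluster pi i) u| <= 3 * d})) => i.
  have [pi_i|/eqP neq_i] := eqVneq (pi i) i; last by exists true.
  have [||b le_b] := @cluster_sparse _ e e_sym (cluster pi i) d i; last by exists b.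
    by rewrite inE pi_i.
  by move=> x y; rewrite !inE => /eqP xi /eqP yi; apply: close; rewrite xi yi.
pose budget := k * k + (4 * k + 3) * d.
have le_budget : k.-1 * budget <= n - 1.
  have k9 : k ^ 9 = k * k ^ 8 by rewrite -expnS.
  have k8 : k ^ 8 = k * (k * k ^ 6) by rewrite -!expnS.
  have k6 : 0 < k ^ 6 by rewrite expn_gt0 k_gt0.
  have le_d : (4 * k + 3) * d <= 7 * k * (21 * k ^ 6 * k) by apply: leq_mul; rewrite /d; lia.
  have le_kk : k * k <= k * (k * k ^ 6) by rewrite mulnA leq_pmulr.
  have le_b : budget <= 148 * k ^ 8 by rewrite /budget k8; lia.
  have le_kb : k.-1 * budget <= k * (148 * k ^ 8) by rewrite leq_mul ?leq_pred.
  have k9_gt0 : 0 < k ^ 9 by rewrite expn_gt0 k_gt0.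
  by lia.
have [p lt_p|s sz_s rich] := @exists_labels _ pi (n - 1) budget k.-1.
  apply: leq_ltn_trans ltT; apply: (@leq_trans ((n - 1) * p + (n - 1) * 1)).
    by rewrite leq_add2l muln1 (leq_trans _ le_budget) // leq_mul2r leR orbT.
  by rewrite -mulnDr leq_mul2l addn1 (subn1 k) lt_p orbT.
have [|i rich_i] := @exists_rich_label _ pi (n - 1) s.
  by rewrite sz_s -subn1.
suff : k <= max_distinct_degrees e by rewrite leqNgt few.
exact: (many_degrees_of_labels e_sym e_irr pi_id k_gt0 lt_hom close far sparse sz_s rich rich_i).
Qed.
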